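(* Let $R$ be a ring, and let $A,B$ be two similar right ideals of $R$. Suppose that $A$ has a serial factorization. Then: (1) $B$ has a serial factorization. (2) Either $A=B$ or the right $R$-module $R/A\cong R/B$ is uniserial.
   Context: Rings are associative with identity $1\neq 0$, not necessarily commutative. Two right ideals $A,B$ of $R$ are similar if the right $R$-modules $R/A$ and $R/B$ are isomorphic. The product $IJ$ of two right ideals is the set of finite sums of products $xy$ with $x\in I$, $y\in J$. A right module is uniserial if its lattice of submodules is linearly ordered by inclusion. A finite family $\{A_1,\dots,A_n\}$ of proper right ideals of $R$ is coindependent if $A_i+\bigcap_{j\neq i}A_j=R$ for every $i$ (an empty intersection being $R$). A serial factorization of a right ideal $A$ of $R$ is a factorization $A=A_1\cdots A_n$ where $A_1,\dots,A_n$ are proper right ideals of $R$ forming a coindependent family, $A_iA_j=A_jA_i$ for all $i,j$, and $R/A_i$ is a uniserial right $R$-module for every $i$. The improper ideal $R$ is regarded as having the empty serial factorization ($n=0$). *)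

(* Defs.v *)
From HB Require Import structures.
From mathcomp Require Import all_boot all_algebra generic_quotient.
From mathcomp Require Import boolp classical_sets.

Set Implicit Arguments.
Unset Strict Implicit.
Unset Printing Implicit Defensive.

Import GRing.Theory.
Local Open Scope ring_scope.
Local Open Scope quotient_scope.
Local Open Scope classical_set_scope.

(* MathComp's modules are left modules, so a right R-module is a left module
   over the converse ring, [lmodType R^c]: [r *: m] there stands for m r. *)

Record rideal (R : nzRingType) := RIdeal {
  rideal_set :> set R;
  rideal0 : rideal_set 0;
  ridealD : forall x y, rideal_set x -> rideal_set y -> rideal_set (x + y);
  ridealMr : forall x r, rideal_set x -> rideal_set (x * r) }.

Section QuotientModule.
Variables (R : nzRingType) (I : rideal R).

Definition rideal_pred : {pred R} := fun x => `[< rideal_set I x >].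

Fact rideal_pred_zmod : zmod_closed rideal_pred.
Proof.
split=> [|x y /asboolP Ix /asboolP Iy]; apply/asboolP; first exact: rideal0.
by apply: ridealD => //; rewrite -mulrN1; exact: ridealMr.
Qed.

HB.instance Definition _ :=
  GRing.isZmodClosed.Build R rideal_pred rideal_pred_zmod.

Definition rquot := Quotient.quot rideal_pred.

HB.instance Definition _ := GRing.Zmodule.on rquot.
HB.instance Definition _ := EqQuotient.on rquot.

Definition rquot_scale (r : R^c) (u : rquot) : rquot :=
  \pi_rquot (repr u * (r : R)).

Lemma rquotP (x y : R) : reflect (rideal_set I (x - y)) (\pi_rquot x == \pi_rquot y).
Proof.
have -> : (\pi_rquot x == \pi_rquot y) = (x - y \in rideal_pred).
  by rewrite Quotient.idealrBE.
exact: asboolP.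
Qed.

Lemma rquot_piD (x y : R) : \pi_rquot (x + y) = \pi_rquot x + \pi_rquot y.
Proof. exact: pi_addr. Qed.

Lemma rquot_scaleE (r x : R) : rquot_scale r (\pi x) = \pi_rquot (x * r).
Proof.
apply/eqP/rquotP; rewrite -mulrBl; apply: ridealMr; apply/rquotP.
by rewrite reprK.
Qed.

Fact rquot_scaleA (a b : R^c) v :
  rquot_scale a (rquot_scale b v) = rquot_scale (a * b) v.
Proof.
elim/quotW: v => x; rewrite [rquot_scale b _]rquot_scaleE !rquot_scaleE.
by congr (\pi_rquot _); exact: esym (@mulrA R x b a).
Qed.

Fact rquot_scale1 : left_id 1 rquot_scale.
Proof. by move=> v; rewrite -[v]reprK rquot_scaleE mulr1. Qed.

Fact rquot_scaleDr : right_distributive rquot_scale +%R.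
Proof.
move=> a u v; rewrite -[u]reprK -[v]reprK.
by rewrite -rquot_piD !rquot_scaleE mulrDl rquot_piD.
Qed.

Fact rquot_scaleDl v : {morph rquot_scale^~ v : a b / a + b}.
Proof.
by move=> a b; rewrite -[v]reprK !rquot_scaleE mulrDr rquot_piD.
Qed.

HB.instance Definition _ := GRing.Zmodule_isLmodule.Build R^c rquot
  rquot_scaleA rquot_scale1 rquot_scaleDr rquot_scaleDl.

End QuotientModule.

Definition similar_rideals (R : nzRingType) (A B : rideal R) : Prop :=
  exists f : {linear rquot A -> rquot B}, bijective f.

Definition uniserial (S : nzRingType) (M : lmodType S) : Prop :=
  forall N1 N2 : set M, submod_closed (mem N1) -> submod_closed (mem N2) ->
    N1 `<=` N2 \/ N2 `<=` N1.

Definition set_add (R : nzRingType) (I J : set R) : set R :=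
  [set s | exists x y, [/\ I x, J y & s = x + y]].

Definition set_mul (R : nzRingType) (I J : set R) : set R :=
  [set s | exists (k : nat) (x y : 'I_k -> R),
    (forall i, I (x i) /\ J (y i)) /\ s = \sum_(i < k) x i * y i].

Definition proper_rideal (R : nzRingType) (I : rideal R) : Prop :=
  (I : set R) <> setT.

Definition coindependent (R : nzRingType) (n : nat) (F : 'I_n -> rideal R) :
    Prop :=
  (forall i, proper_rideal (F i)) /\
  forall i, set_add (F i) (\bigcap_(j in [set j | j != i]) F j) = setT.

(* The iterated product is F_0 (F_1 (... (F_(n-1) R))); for n > 0 the trailing
   factor R is harmless since I R = I for a right ideal I. For n = 0 it is R,
   so that exactly the improper ideal has the empty serial factorization. *)
Definition serial_factorization (R : nzRingType) (A : rideal R) (n : nat)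
    (F : 'I_n -> rideal R) : Prop :=
  [/\ (A : set R) = \big[@set_mul R/setT]_(i < n) (F i : set R),
      coindependent F,
      forall i j, set_mul (F i) (F j) = set_mul (F j) (F i)
    & forall i, uniserial (rquot (F i) : lmodType R^c)].

Definition has_serial_factorization (R : nzRingType) (A : rideal R) : Prop :=
  exists (n : nat) (F : 'I_n -> rideal R), serial_factorization A F.

(* Main.v *)
Require Import Defs.
From mathcomp Require Import all_boot all_algebra.
From mathcomp Require Import boolp classical_sets.

Local Open Scope ring_scope.

(** If the factorization has at least two factors, coindependence and
    commutation force every factor, hence [A], to be a two-sided ideal.  In the
    right uniserial ring [R/A_i] the only idempotents are [0] and [1], so
    [y x = 1] modulo [A] forces the idempotent [1 - x y] of [R/A] into every
    [A_i], and then into their product.  Thus [R/A] is directly finite, and for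
    a two-sided ideal [A] with this property similarity to [B] means equality.
    With a single factor, [R/A] itself is uniserial. *)

Set Implicit Arguments.
Unset Strict Implicit.
Unset Printing Implicit Defensive.

Import GRing.Theory.
Local Open Scope quotient_scope.
Local Open Scope classical_set_scope.

(** * Right ideals and their products *)

Section RightIdeals.
Variable R : nzRingType.
Implicit Types (I J A B : rideal R) (X Y : set R).

(** The closure fields are propositions, hence irrelevant. Leibniz equality lets a factorization of
    [A] serve for [B]. *)
Lemma rideal_ext I J : (I : set R) = J -> I = J.
Proof.
case: I J => [I I0 ID IM] [J J0 JD JM] /= eIJ; case: _ / eIJ in J0 JD JM *.
by congr RIdeal; exact: Prop_irrelevance.
Qed.

Lemma ridealB I x y : rideal_set I x -> rideal_set I y -> rideal_set I (x - y).
Proof.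
by move=> Ix Iy; apply: ridealD => //; rewrite -mulrN1; exact: ridealMr.
Qed.

Lemma ridealBl I x y : rideal_set I (x - y) -> rideal_set I y -> rideal_set I x.
Proof. by move=> Ixy Iy; rewrite -[x](subrK y); exact: ridealD. Qed.

Lemma ridealBr I x y : rideal_set I (x - y) -> rideal_set I x -> rideal_set I y.
Proof. by move=> Ixy Ix; rewrite -[y](subKr x); exact: ridealB. Qed.

Lemma rideal_eqT I : rideal_set I 1 -> (I : set R) = setT.
Proof.
by move=> I1; apply/seteqP; split=> // r _; rewrite -[r]mul1r; exact: ridealMr.
Qed.

Lemma rideal_sum I n (x : 'I_n -> R) :
  (forall i, rideal_set I (x i)) -> rideal_set I (\sum_i x i).
Proof.
by move=> Ix; elim/big_ind: _ => // [|u v]; [exact: rideal0|exact: ridealD].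
Qed.

Lemma mem_set_mul X Y x y : X x -> Y y -> set_mul X Y (x * y).
Proof.
by move=> Xx Yy; exists 1%N, (fun=> x), (fun=> y); rewrite big_ord1.
Qed.

Lemma set_mul_subl I X : set_mul I X `<=` I.
Proof.
move=> _ [k [x [y [xy ->]]]]; apply: rideal_sum => i.
by apply: ridealMr; case: (xy i).
Qed.

Lemma set_mulT I : set_mul I setT = I.
Proof.
apply/seteqP; split; first exact: set_mul_subl.
by move=> x Ix; rewrite -[x]mulr1; exact: mem_set_mul.
Qed.

(** On a [rideal] this is what makes it two-sided. *)
Definition left_ideal X := forall r x, X x -> X (r * x).

Lemma left_ideal_set_mul X Y : left_ideal X -> left_ideal (set_mul X Y).
Proof.
move=> lX r _ [k [x [y [xy ->]]]]; exists k, (fun i => r * x i), y.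
split=> [i|]; first by have [Xx Yy] := xy i; split=> //; exact: lX.
by rewrite mulr_sumr; apply: eq_bigr => i _; rewrite mulrA.
Qed.

Lemma set_mul_subr X I Y : left_ideal I -> Y `<=` I -> set_mul X Y `<=` I.
Proof.
move=> lI YI _ [k [x [y [xy ->]]]]; apply: rideal_sum => i.
by apply: lI; apply: YI; case: (xy i).
Qed.

Section Products.
Variables (T : eqType) (F : T -> rideal R).

Lemma big_set_mul_sub (s : seq T) t : (forall t, left_ideal (F t)) -> t \in s ->
  \big[@set_mul R/setT]_(u <- s) (F u : set R) `<=` F t.
Proof.
move=> lF; elim: s => //= u s IHs; rewrite inE big_cons.
have [-> _|_ /= ts] := eqVneq t u; first exact: set_mul_subl.
by apply: set_mul_subr => //; exact: IHs.
Qed.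

(** Each ideal contributes one factor [d]; the empty product [R] contains [d ^+ 0]. *)
Lemma exp_big_set_mul (s : seq T) d : (forall t, rideal_set (F t) d) ->
  (\big[@set_mul R/setT]_(u <- s) (F u : set R)) (d ^+ size s).
Proof.
move=> Fd; elim: s => [|u s IHs]; first by rewrite big_nil.
by rewrite big_cons exprS; exact: mem_set_mul.
Qed.

End Products.

(** Write [r = a + b] with [a] in [I] and [b] in [J]: [a x] is in [I], and [b x] is in [J I = I J],
    which lies in [I]. *)
Lemma coprime_comm_left_ideal I J : set_add I J = setT ->
  set_mul I J = set_mul J I -> left_ideal I.
Proof.
move=> IJT IJC r x Ix.
have [a [b [Ia Jb ->]]] : set_add I J r by rewrite IJT.
rewrite mulrDl; apply: ridealD; first exact: ridealMr.
by apply: (@set_mul_subl I J); rewrite IJC; exact: mem_set_mul.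
Qed.

(** * Uniserial quotients and direct finiteness *)

Lemma rquot_scalepi I (a : R^c) x :
  a *: \pi_(rquot I) x = \pi_(rquot I) (x * (a : R)).
Proof. exact: rquot_scaleE. Qed.

Lemma pi_rquot0 I x : \pi_(rquot I) x = 0 <-> rideal_set I x.
Proof.
have <- : \pi_(rquot I) 0 = 0 by exact: pi_zeror.
by split=> [/eqP/rquotP|Ix]; [rewrite subr0|apply/eqP/rquotP; rewrite subr0].
Qed.

(** The cyclic submodules generated by the classes of [x] and [y] are comparable. *)
Lemma uniserial_rquot_dvd I x y : uniserial (rquot I : lmodType R^c) ->
  (exists r, rideal_set I (x - y * r)) \/ (exists r, rideal_set I (y - x * r)).
Proof.
pose M z : set (rquot I) := range (fun r => \pi_(rquot I) (z * r)).
have subM z : submod_closed (mem (M z)).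
  split=> [|a u v].
    by apply/mem_set; exists 0 => //; rewrite mulr0; exact: pi_zeror.
  move=> /set_mem[r _ <-] /set_mem[s _ <-]; apply/mem_set.
  exists (r * a + s) => //; rewrite mulrDr rquot_piD mulrA.
  by rewrite rquot_scalepi.
have Mz z : M z (\pi_(rquot I) z) by exists 1; rewrite ?mulr1.
move=> /(_ (M x) (M y) (subM x) (subM y))[] sM; [left|right].
  have [r _ /esym/eqP/rquotP Ir] := sM _ (Mz x); by exists r.
have [r _ /esym/eqP/rquotP Ir] := sM _ (Mz y); by exists r.
Qed.

Definition directly_finite_mod X := forall x y, X (y * x - 1) -> X (1 - x * y).

Lemma mod_idem I x y : left_ideal I -> rideal_set I (y * x - 1) ->
  rideal_set I (x * y * (1 - x * y)).
Proof.
move=> lI Iyx; have -> : x * y * (1 - x * y) = - (x * (y * x - 1) * y).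
  by rewrite !(mulrBr, mulrBl) !mulr1 !mulrA opprB.
by rewrite -mulrN1; do 2!apply: ridealMr; exact: lI.
Qed.

(** Modulo [I], [e = x y] and [d = 1 - e] are orthogonal idempotents, and one is a right multiple of
    the other; that multiple has square zero, hence vanishes. *)
Lemma uniserial_directly_finite I : left_ideal I ->
  uniserial (rquot I : lmodType R^c) -> directly_finite_mod I.
Proof.
move=> lI uI x y Iyx; have Ied := mod_idem lI Iyx.
set e := x * y in Ied *; set d := 1 - e in Ied *.
have deC : d * e = e * d by rewrite mulrBl mulrBr mul1r mulr1.
have sum1 : d + e = 1 by rewrite subrK.
have [[r Ir]|[r Ir]] := uniserial_rquot_dvd d e uI.
  have Idd : rideal_set I (d * d).
    apply: (ridealBl (y := d * e * r)).
      by rewrite -mulrA -mulrBr; exact: lI.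
    by rewrite deC; exact: ridealMr.
  by rewrite -[d]mul1r -{1}sum1 mulrDl; exact: ridealD.
have Iee : rideal_set I (e * e).
  apply: (ridealBl (y := e * d * r)).
    by rewrite -mulrA -mulrBr; exact: lI.
  exact: ridealMr.
have Ie : rideal_set I e.
  by rewrite -[e]mul1r -{1}sum1 mulrDl deC; exact: ridealD.
(* Modulo [I], [y x] equals [y x y x = y e x], which is now zero; so [1] is in [I], and [d] with
   it. *)
have Iyx1 : rideal_set I (y * x).
  apply: (ridealBr (x := y * x * (y * x))).
    by rewrite -[X in _ - X]mulr1 -mulrBr; exact: lI.
  by rewrite -mulrA [x * _]mulrA mulrA; apply: ridealMr; exact: lI.
by rewrite -[d]mul1r; apply: ridealMr; exact: ridealBr Iyx Iyx1.
Qed.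

(** Exponents descend to 1, since [d ^+ n.+1 - d ^+ n.+2 = (1 - d) d d ^+ n] is in [I]; exponent 0
    means [I = R]. *)
Lemma mod_idem_exp I d n : rideal_set I ((1 - d) * d) ->
  rideal_set I (d ^+ n) -> rideal_set I d.
Proof.
move=> Id; elim: n => [|n IHn] Idn.
  by rewrite -[d]mul1r; exact: ridealMr.
case: n IHn Idn => [_ //|n IHn Idn]; apply: IHn.
apply: ridealBl (Idn); rewrite -[X in X - _]mul1r [_ ^+ n.+2]exprS -mulrBl.
by rewrite exprS mulrA; exact: ridealMr.
Qed.

(** * Transfer along an isomorphism of quotients *)

Section Similar.
Variables (A B : rideal R) (f : {linear rquot A -> rquot B}).
Hypothesis f_bij : bijective f.

Lemma similar_setT : (B : set R) = setT -> (A : set R) = setT.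
Proof.
move=> BT; apply: rideal_eqT; apply/pi_rquot0; apply: (bij_inj f_bij).
by rewrite raddf0 -[f _]reprK; apply/pi_rquot0; rewrite BT.
Qed.

Lemma similar_uniserial :
  uniserial (rquot A : lmodType R^c) -> uniserial (rquot B : lmodType R^c).
Proof.
have [g fK gK] := f_bij.
have sub N : submod_closed (mem N) -> submod_closed (mem (f @^-1` N)).
  move=> [N0 ND]; split=> [|a u v /set_mem Nu /set_mem Nv]; apply/mem_set => /=.
    by rewrite raddf0; exact/set_mem.
  by rewrite linearP; apply/set_mem/ND; exact/mem_set.
move=> uA N1 N2 /sub sN1 /sub sN2.
by have [] := uA _ _ sN1 sN2 => sN; [left|right] => u Nu;
  rewrite -[u]gK; apply: sN; rewrite /= gK.
Qed.

Lemma similar_two_sided_eq : left_ideal A -> directly_finite_mod A ->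
  (A : set R) = B.
Proof.
move=> lA finA; have f_inj := bij_inj f_bij.
have [g fK gK] := f_bij.
(* Lifts of the images of [1] under [f] and its inverse: [f] sends the class of [y r] to that of
   [r], so [y x] is [1] modulo [A]. *)
pose x := repr (f (\pi 1)); pose y := repr (g (\pi 1)).
have fy r : f (\pi_(rquot A) (y * r)) = \pi_(rquot B) r.
  by rewrite -(rquot_scalepi A r) linearZ /= reprK gK rquot_scalepi mul1r.
have Ayx : rideal_set A (y * x - 1).
  by apply/rquotP/eqP/f_inj; rewrite fy reprK.
have Axy := finA _ _ Ayx.
apply/seteqP; split=> [a Aa|b Bb].
  apply/pi_rquot0; rewrite -fy.
  by have /(pi_rquot0 A) -> := lA y _ Aa; rewrite raddf0.
have Ayb : rideal_set A (y * b).
  by apply/pi_rquot0/f_inj; rewrite fy raddf0; apply/pi_rquot0.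
(* Here [b = (1 - x y) b + x (y b)], where [1 - x y] is in [A] by direct finiteness. *)
rewrite -[b]mul1r -(subrK (x * y) 1) mulrDl.
apply: ridealD; first exact: ridealMr.
by rewrite -mulrA; exact: lA.
Qed.

End Similar.

(** * Factorizations whose length is not one *)

Section Factorization.
Variables (A : rideal R) (n : nat) (F : 'I_n -> rideal R).
Hypothesis fact_A : serial_factorization A F.

(** A second index [j] exists once there is an [i], and [F j] contains the intersection in the
    coindependence condition, so [F i + F j = R]. *)
Lemma serial_factorization_left_ideal : n != 1%N -> forall i, left_ideal (F i).
Proof.
have [_ [_ coF] comF _] := fact_A; move=> n1 i.
have [j ji] : exists j, j != i.
  apply/existsP; rewrite -negb_forall; apply: contraNN n1 => /forallP all_i.
  rewrite -[n]card_ord; apply/eqP; apply: (eq_card1 (x := i)) => j.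
  by rewrite !inE (eqP (all_i j)) eqxx.
apply: (coprime_comm_left_ideal (J := F j)) (comF i j).
apply/seteqP; split=> // r _.
have : set_add (F i) (\bigcap_(j in [set j | j != i]) F j) r by rewrite coF.
by move=> [a [b [Fa Fb ->]]]; exists a, b; split=> //; exact: Fb.
Qed.

Lemma serial_factorization_two_sided : n != 1%N ->
  left_ideal A /\ directly_finite_mod A.
Proof.
move=> n1; have lF := serial_factorization_left_ideal n1.
have [A_F _ _ uF] := fact_A.
have lA : left_ideal A.
  by rewrite A_F; elim/big_ind: _ => // X Y lX _; exact: left_ideal_set_mul.
(* As [d = 1 - x y] is idempotent modulo [A], a power of [d] in the product suffices; each [F i]
   contains [A], hence contains [d]. *)
split=> // x y Ayx; apply: (mod_idem_exp (n := size (index_enum 'I_n))).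
  by rewrite subKr; exact: mod_idem.
rewrite A_F; apply: exp_big_set_mul => i.
apply: uniserial_directly_finite => //; rewrite A_F in Ayx.
by apply: big_set_mul_sub Ayx => //; rewrite mem_index_enum.
Qed.

End Factorization.

Lemma has_serial_factorization_uniserial I : proper_rideal I ->
  uniserial (rquot I : lmodType R^c) -> has_serial_factorization I.
Proof.
move=> pI uI; exists 1%N, (fun=> I); split=> //.
  by rewrite big_ord_recl big_ord0 set_mulT.
(* With a single index the intersection is empty, hence equal to [R]. *)
split=> // i; apply/seteqP; split=> // r _; exists 0, r.
by split; [exact: rideal0|move=> j; rewrite /= !ord1|rewrite add0r].
Qed.

End RightIdeals.

Theorem theorem3p4 (R : nzRingType) (A B : rideal R) :
  similar_rideals A B -> has_serial_factorization A ->
  has_serial_factorization B /\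
  ((A : set R) = (B : set R) \/
   (uniserial (rquot A : lmodType R^c) /\ uniserial (rquot B : lmodType R^c))).
Proof.
move=> [f f_bij] [n [F fact_A]]; have [n1|n1] := eqVneq n 1%N; last first.
  have [lA finA] := serial_factorization_two_sided fact_A n1.
  have AB := similar_two_sided_eq f_bij lA finA.
  by split; [rewrite -(rideal_ext AB); exists n, F|left].
case: _ / (esym n1) in F fact_A *; case: fact_A => A_F [pF _] _ uF.
(* The single factor is [A] itself, the trailing [R] being absorbed. *)
have AF : A = F ord0.
  by apply: rideal_ext; rewrite A_F big_ord_recl big_ord0 set_mulT.
have uA : uniserial (rquot A : lmodType R^c) by rewrite AF.
have uB := similar_uniserial f_bij uA; split; last by right.
apply: has_serial_factorization_uniserial => // /(similar_setT f_bij).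
by rewrite AF; exact: pF.
Qed.
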